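(* Let $(M,\mathcal T)$ be a triangulated compact pseudo $3$-manifold, and let $\alpha$ be a semi-angle structure on $(M,\mathcal T)$ with area-curvature $(A,\kappa)$, where $(A,\kappa)$ is a flat area-curvature function (with respect to $\alpha$). Suppose that around each edge $e$ of $\mathcal T$ at least one dihedral angle of $\alpha$ lies in $(0,\pi)$. Then there exists a function $A'$ on the normal triangle types of $\mathcal T$ with $A'<0$ (i.e. $A'(t)<0$ for every normal triangle type $t$) such that $(M,\mathcal T)$ admits an angle structure with area-curvature $(A',\kappa)$.
   Context: Triangulated compact pseudo $3$-manifold. Let $X=\{\sigma_1,\dots,\sigma_n\}$ be a finite collection of pairwise disjoint $3$-simplices and $\Phi$ a set of affine isomorphisms pairing faces of these simplices (some faces may remain unpaired). The quotient $M=X/\Phi$ is a compact pseudo $3$-manifold, and $\mathcal T$ is the collection of images of all simplices of the $\sigma_i$; these images are the vertices, edges, faces and tetrahedra of $\mathcal T$. $\partial M$ is the union of the images of the unpaired faces. An edge of some $\sigma_i$ (before identification) is denoted $e_{ik}$, $1\le i\le n$, $1\le k\le 6$. The dihedral angles around an edge $e$ of $\mathcal T$ are the angles at all $e_{ik}$ mapped to $e$. Normal triangle types. For each tetrahedron $\sigma_i$ and each vertex $v$ of $\sigma_i$ there is one normal triangle type, cutting off $v$ and meeting the three edges of $\sigma_i$ at $v$; so there are $4n$ normal triangle types. Given an assignment $\alpha$ of dihedral angles, the angles of a normal triangle are the three dihedral angles at the edges it meets. Angle structures with area-curvature. Let $A$ be a real function on the normal triangle types and $\kappa$ a real function on the edges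 of $\mathcal T$. A generalized angle structure with area-curvature $(A,\kappa)$ on $(M,\mathcal T)$ is a function $\alpha$ assigning to each $e_{ik}$ a real number $\alpha(e_{ik})$ (the dihedral angle) such that: (1) for every normal triangle type $t$ in $\sigma_i$, meeting the three edges $e_{ia},e_{ib},e_{ic}$ of $\sigma_i$, $\alpha(e_{ia})+\alpha(e_{ib})+\alpha(e_{ic})-\pi=A(t)$; (2) for every edge $e$ of $\mathcal T$, with sum over all $e_{ik}$ mapped to $e$, $\kappa(e)=2\pi-\sum\alpha(e_{ik})$ if $e\not\subset\partial M$, and $\kappa(e)=\pi-\sum\alpha(e_{ik})$ if $e\subset\partial M$. It is a semi-angle structure with area-curvature $(A,\kappa)$ if all $\alpha(e_{ik})\in[0,\pi]$, and an angle structure with area-curvature $(A,\kappa)$ if all $\alpha(e_{ik})\in(0,\pi)$. Flat area-curvature function. $(A,\kappa)$ (the area-curvature of the semi-angle structure $\alpha$) is flat if $A\le0$, $A(t)=0$ precisely for those normal triangles $t$ whose three angles under $\alpha$ are, up to order, $(0,0,\pi)$, and $A(t)<0$ for all other normal triangles $t$. *)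

(* Defs.v *)
From HB Require Import structures.
From mathcomp Require Import all_boot all_order all_algebra.
From mathcomp Require Import all_fingroup.
From mathcomp Require Import all_classical all_reals all_analysis.

Set Implicit Arguments.
Unset Strict Implicit.
Unset Printing Implicit Defensive.
Import Order.TTheory GRing.Theory Num.Theory.

Local Open Scope ring_scope.

(* The simplices are indexed by 'I_n, each with vertex set 'I_4; the face
   (i, v) is the face of the simplex i opposite to its vertex v.
   [face_glue i v = None] means that this face is unpaired.
   [face_glue i v = Some (j, p)] means that it is paired with the face (j, p v) by
   the affine isomorphism that sends the vertex w of i to the vertex p w of j,
   for every w != v.  An affine isomorphism between two triangles is determined
   by its bijection on the vertices, which extends to a unique permutation of
   'I_4 sending v to the vertex opposite to the target face.  Each pairing is
   recorded from both of its faces, by mutually inverse maps. *)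
Record triangulation (n : nat) := Triangulation {
  face_glue : 'I_n -> 'I_4 -> option ('I_n * {perm 'I_4});
  face_glue_sym : forall i v j p,
    face_glue i v = Some (j, p) -> face_glue j (p v) = Some (i, (p^-1)%g);
  face_glue_neq : forall i v j p,
    face_glue i v = Some (j, p) -> (j, p v) != (i, v)
}.

Definition simplex_edge := {E : {set 'I_4} | #|E| == 2%N}.

(* The 6n edges e_{ik} of the simplices, before identification. *)
Definition local_edge (n : nat) := ('I_n * simplex_edge)%type.

(* (i, v) is the normal triangle type of the simplex i cutting off v. *)
Definition normal_triangle (n : nat) := ('I_n * 'I_4)%type.

Section Edges.
Variables (n : nat) (T : triangulation n).

(* e lies in a paired face, and the pairing carries e onto e'. *)
Definition edge_glued : rel (local_edge n) := fun e e' =>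
  [exists v : 'I_4, (v \notin val e.2) &&
    (if face_glue T e.1 v is Some (j, p)
     then (e'.1 == j) && (val e'.2 == [set p w | w in val e.2])
     else false)].

(* The set of all e_{ik} with the same image as e in the quotient.
   [edge_glued] is symmetric, by [face_glue_sym], so that [connect edge_glued] is the
   equivalence relation that it generates. *)
Definition edge_class (e : local_edge n) : {set local_edge n} :=
  [set e' | connect edge_glued e e'].

(* An edge of the triangulation is represented by the set of the e_{ik} that
   are mapped to it. *)
Definition edge :=
  {C : {set local_edge n} | C \in [set edge_class e | e : local_edge n]}.

(* The boundary is the union of the images of the unpaired faces. *)
Definition in_boundary (C : edge) : bool :=
  [exists e in val C, [exists v : 'I_4,
    (v \notin val e.2) && (face_glue T e.1 v == None)]].

End Edges.

Section AngleStructures.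
Variables (R : realType) (n : nat) (T : triangulation n).
Implicit Types (A : normal_triangle n -> R) (kappa : edge T -> R).
Implicit Types (alpha : local_edge n -> R) (t : normal_triangle n).

Definition triangle_angles alpha t : seq R :=
  [seq alpha (t.1, E) | E in [pred E : simplex_edge | t.2 \in val E]].

Definition generalized_angle_structure A kappa alpha : Prop :=
  (forall t, (\sum_(x <- triangle_angles alpha t) x) - pi = A t) /\
  (forall C : edge T,
     kappa C = (if in_boundary C then pi else 2 * pi)
               - \sum_(e in val C) alpha e).

Definition semi_angle_structure A kappa alpha : Prop :=
  generalized_angle_structure A kappa alpha /\
  (forall e, 0 <= alpha e <= pi).

Definition angle_structure A kappa alpha : Prop :=
  generalized_angle_structure A kappa alpha /\
  (forall e, 0 < alpha e < pi).

Definition flat_triangle alpha t : Prop :=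
  perm_eq (triangle_angles alpha t) [:: 0; 0; pi].

(* Flatness of (A, kappa) with respect to alpha constrains only A. *)
Definition flat_area_curvature alpha A : Prop :=
  [/\ forall t, A t <= 0,
      forall t, A t = 0 <-> flat_triangle alpha t
    & forall t, ~ flat_triangle alpha t -> A t < 0].

End AngleStructures.

(* Main.v *)
Require Import Defs.
From HB Require Import structures.
From mathcomp Require Import all_boot all_order all_algebra.
From mathcomp Require Import all_fingroup.
From mathcomp Require Import all_classical all_reals all_analysis.
From mathcomp Require Import lra.

Set Implicit Arguments.
Unset Strict Implicit.
Unset Printing Implicit Defensive.
Import Order.TTheory GRing.Theory Num.Theory.
Import numFieldNormedType.Exports.

Local Open Scope ring_scope.

(** The structure [alpha] is moved along a line [alpha + x * d], with a direction [d]
    that repairs to first order everything that is not already strict.  An angle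
    [0] has to increase, an angle [pi] has to decrease, and the area of a
    triangle with angles [(0, 0, pi)] has to decrease.  Speed [1] at the angles
    [0] and speed [-3] at the angles [pi] do all of this, the area of such a
    triangle having speed [1 + 1 - 3 = -1] ([boundary_speed_flat]).

    These speeds change the curvatures.  The change is undone at the angles in
    [(0, pi)]: each edge has one, and the opposite of the total speed around the
    edge is shared equally among them ([sum_balance]).  Because no angle of a
    triangle [(0, 0, pi)] is in [(0, pi)], the compensation leaves these
    triangles alone.  The constraints at angles in [(0, pi)] and at triangles of
    negative area are strict at [alpha], hence stable.  So each of the finitely
    many constraints holds for all small [x > 0] ([affine_gt0_near0]), and one
    [x] serves them all. *)

(** * First-order perturbation of finitely many inequalities *)

(** The form of all the constraints of the theorem along the line: a strict one
    is kept for small [x], a tight one becomes strict if its speed is positive. *)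
Lemma affine_gt0_near0 (R : realType) (a b : R) :
    0 < a \/ (0 <= a /\ 0 < b) ->
  \forall x \near (0 : R)^'+%classic, 0 < a + x * b.
Proof.
case=> [a_gt0|[a_ge0 b_gt0]]; near=> x; last first.
  by apply: ltr_wpDl => //; apply: mulr_gt0.
have x_gt0 : 0 < x by [].
have b1_gt0 : 0 < 1 + `|b| by rewrite ltr_pwDl.
have : x < a / (1 + `|b|) by near: x; apply: nbhs_right_lt; rewrite divr_gt0.
rewrite ltr_pdivlMr // mulrDr mulr1 => lt_xa.
have : - (x * `|b|) <= x * b by rewrite -mulrN ler_pM2l // lerNl -normrN ler_norm.
lra.
Unshelve. all: by end_near. Qed.

(** * Compensation along the blocks of a partition *)

(** The total of [g] over the block of [e] is taken off in equal parts from the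
    elements of the block in [P]; outside [P] the values of [g] are kept. *)
Definition balance (R : fieldType) (I : finType) (cls : I -> {set I})
    (P : pred I) (g : I -> R) (e : I) : R :=
  g e - if P e then (\sum_(e' in cls e) g e') / #|[set e' in cls e | P e']|%:R
        else 0.

Lemma sum_balance (R : numFieldType) (I : finType) (cls : I -> {set I})
    (P : pred I) (g : I -> R) (C : {set I}) :
    {in C, forall e, cls e = C} -> (exists2 e, e \in C & P e) ->
  \sum_(e in C) balance cls P g e = 0.
Proof.
move=> clsC [e0 e0C Pe0]; rewrite /balance sumrB -big_mkcondr /=.
pose c := (\sum_(e in C) g e) / #|[set e in C | P e]|%:R.
rewrite [X in _ - X](eq_bigr (fun=> c)); last first.
  by move=> e /andP[/clsC -> _].
rewrite sumr_const -[X in _ *+ X](@eq_card _ (mem [set e in C | P e])); last first.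
  by move=> e; rewrite inE.
rewrite -mulrnAr -[X in _ * X]mulr_natr mulVf ?mulr1 ?subrr //.
by rewrite pnatr_eq0 -lt0n; apply/card_gt0P; exists e0; rewrite inE e0C.
Qed.

(** * Edge classes *)

Lemma edge_glued_sym (n : nat) (T : triangulation n) : symmetric (edge_glued T).
Proof.
suff glueW e e' : edge_glued T e e' -> edge_glued T e' e.
  by move=> e e'; apply/idP/idP => /glueW.
case/existsP=> v /andP[ve]; case Tv: (face_glue T e.1 v) => [[j p]|] //.
case/andP=> /eqP e1 /eqP e2; apply/existsP; exists (p v).
rewrite e1 (face_glue_sym Tv) eqxx e2 (mem_imset _ _ perm_inj) ve /=.
rewrite -imset_comp (eq_imset (g := id)) ?imset_id // => w /=.
by rewrite permK.
Qed.

(** A class is defined from one of its elements, by a directed search along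
    [edge_glued]; the symmetry of this relation makes every element of the class
    define it, so that the classes are disjoint. *)
Lemma edge_class_eq (n : nat) (T : triangulation n) (C : edge T) :
  {in val C, forall e, edge_class T e = val C}.
Proof.
case: C => C /= /imsetP[e0 _ ->] e; rewrite inE => e0e.
apply/setP => e'; rewrite !inE.
exact/esym/(same_connect (sym_connect_sym (@edge_glued_sym _ T))).
Qed.

(** * The direction of the perturbation *)

Section Direction.
Variable R : realType.

(** The speed [-3] beats the two speeds [1] of a triangle [(0, 0, pi)]. *)
Definition boundary_speed (x : R) : R :=
  if x == 0 then 1 else if x == pi then -3 else 0.

Lemma boundary_speed0 : boundary_speed 0 = 1.
Proof. by rewrite /boundary_speed eqxx. Qed.

Lemma boundary_speed_pi : boundary_speed pi = -3.
Proof. by rewrite /boundary_speed gt_eqF ?pi_gt0 // eqxx. Qed.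

Variables (n : nat) (T : triangulation n) (alpha : local_edge n -> R).

Lemma sum_triangle_angles (f : R -> R) (t : normal_triangle n) :
  \sum_(x <- triangle_angles alpha t) f x =
  \sum_(E : simplex_edge | t.2 \in val E) f (alpha (t.1, E)).
Proof. by rewrite /triangle_angles big_image. Qed.

Lemma boundary_speed_flat (t : normal_triangle n) : flat_triangle alpha t ->
  \sum_(E : simplex_edge | t.2 \in val E) boundary_speed (alpha (t.1, E)) = -1.
Proof.
move=> flat_t; rewrite -sum_triangle_angles (perm_big _ flat_t) !big_cons big_nil.
rewrite boundary_speed0 boundary_speed_pi /=; lra.
Qed.

Definition direction : local_edge n -> R :=
  balance (edge_class T) (fun e => 0 < alpha e < pi) (boundary_speed \o alpha).

Lemma direction_boundary (e : local_edge n) :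
  ~~ (0 < alpha e < pi) -> direction e = boundary_speed (alpha e).
Proof. by rewrite /direction /balance => /negbTE ->; rewrite subr0. Qed.

(** The angles [0] and [pi] keep the prescribed speeds, and the triangle has no
    other angle. *)
Lemma direction_flat (t : normal_triangle n) : flat_triangle alpha t ->
  \sum_(E : simplex_edge | t.2 \in val E) direction (t.1, E) = -1.
Proof.
move=> flat_t; rewrite -(boundary_speed_flat flat_t); apply: eq_bigr => E tE.
have : alpha (t.1, E) \in [:: 0; 0; pi].
  by rewrite -(perm_mem flat_t); apply: map_f; rewrite mem_enum.
rewrite !inE orbA orbb => angle; apply: direction_boundary.
by case/orP: angle => /eqP ->; rewrite !ltxx ?andbF.
Qed.

End Direction.

Theorem theorem1p3 (R : realType) (n : nat) (T : triangulation n)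
    (A : normal_triangle n -> R) (kappa : edge T -> R)
    (alpha : local_edge n -> R)
    (halpha : semi_angle_structure A kappa alpha)
    (hflat : flat_area_curvature alpha A)
    (hedge : forall C : edge T,
       exists2 e : local_edge n, e \in val C & 0 < alpha e < pi) :
  exists A' : normal_triangle n -> R,
    (forall t, A' t < 0) /\
    exists alpha' : local_edge n -> R, angle_structure A' kappa alpha'.
Proof.
have [[areaA curvK] angle_bnd] := halpha; have [A_le0 _ A_lt0] := hflat.
pose d := direction T alpha.
pose dA (t : normal_triangle n) := \sum_(E : simplex_edge | t.2 \in val E) d (t.1, E).
have pi0 := pi_gt0 R.
have angle_gt0 : \forall x \near (0 : R)^'+%classic, forall e, 0 < alpha e + x * d e.
  apply: filter_forall => e; apply: affine_gt0_near0.
  have /andP[] := angle_bnd e; rewrite le_eqVlt => /orP[/eqP a0 _|]; last by left.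
  by right; rewrite /d direction_boundary -a0 ?ltxx // boundary_speed0 eqxx ltr01.
have angle_ltpi :
    \forall x \near (0 : R)^'+%classic, forall e, 0 < (pi - alpha e) + x * - d e.
  apply: filter_forall => e; apply: affine_gt0_near0.
  have /andP[_] := angle_bnd e; rewrite le_eqVlt => /orP[/eqP api|]; last first.
    by left; rewrite subr_gt0.
  right; rewrite /d direction_boundary api ?ltxx ?andbF // boundary_speed_pi.
  by split; lra.
have area_lt0 : \forall x \near (0 : R)^'+%classic, forall t, 0 < - A t + x * - dA t.
  apply: filter_forall => t; apply: affine_gt0_near0.
  have [flat_t|/A_lt0] := pselect (flat_triangle alpha t); last first.
    by left; rewrite oppr_gt0.
  by right; rewrite /dA direction_flat // opprK oppr_ge0 A_le0 ltr01.
have [x [[x_gt0 x_ltpi] x_area]] :=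
  filter_ex (filterI (filterI angle_gt0 angle_ltpi) area_lt0).
exists (fun t => A t + x * dA t); split=> [t|].
  by have := x_area t; rewrite mulrN -opprD oppr_gt0.
exists (fun e => alpha e + x * d e); split; last first.
  by move=> e; rewrite x_gt0 /=; have := x_ltpi e; lra.
split=> [t|C].
  rewrite -areaA !(sum_triangle_angles _ id) big_split /= -mulr_sumr -/(dA t).
  by rewrite addrAC.
rewrite curvK big_split /= -mulr_sumr [X in x * X]sum_balance ?mulr0 ?addr0 //.
  exact: edge_class_eq.
exact: hedge.
Qed.
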